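(* Let $\epsilon>0$ and let the horizon be $$N = \left\lceil \frac{1}{2}\cdot\frac{\log\left(\frac{2\|Q_N-P^*\|_*\,\kappa_{P^*}\,\|A_K^*\|\,\|B\|}{\epsilon\,\lambda_{\min}(R)}\right)}{\log\left(\frac{1}{\|A_K^*\|_*}\right)}+1\right\rceil ,$$ where $Q_N\succeq P^*$ (and it is assumed that this expression is well defined, i.e. $A\neq0$, $B\ne 0$, $Q_N\neq P^*$, and that $N\ge 1$). Assume that $\widetilde K_{N-1},\dots,\widetilde K_0\in\mathbb{R}^{m\times n}$ is a sequence of policies such that for all $h\in\{N-1,\dots,0\}$, $$\|\widetilde K_h-\widetilde K_h^*\|\le \varsigma_{h,\epsilon},$$ where $\widetilde K^*_h=(R+B^\top\widetilde P_{h+1}B)^{-1}B^\top\widetilde P_{h+1}A$ and $\widetilde P_{h+1}$ is determined by $\widetilde K_{h+1},\dots,\widetilde K_{N-1}$ through the backward recursion in the context. Then $\|\widetilde K_0-K^*\|\le\epsilon$. Moreover, if in addition $\epsilon<\dfrac{1-\|A-BK^*\|_*}{\kappa_{P^*}^{1/2}\,\|B\|}$, then $\widetilde K_0$ is stabilizing, i.e. the spectral radius of $A-B\widetilde K_0$ is less than $1$.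
   Context: Norms: $\|X\|$ is the spectral norm, $\sigma_{\min}(X)$ the minimum singular value, $\kappa_X$ the (spectral-norm) condition number; for $W\succ0$, $\|X\|_W^2:=\sup_{z\ne0}\frac{z^\top X^\top WXz}{z^\top Wz}$, and $\|X\|_*:=\|X\|_{P^*}$ with $P^*$ as below. $e$ is Euler's number. Setting: $A\in\mathbb{R}^{n\times n}$, $B\in\mathbb{R}^{n\times m}$ with $(A,B)$ stabilizable; $Q\in\mathbb{R}^{n\times n}$, $R\in\mathbb{R}^{m\times m}$ symmetric positive definite. $P^*$ is the unique positive definite solution of $P=A^\top PA-A^\top PB(R+B^\top PB)^{-1}B^\top PA+Q$, $K^*:=(R+B^\top P^*B)^{-1}B^\top P^*A$, and $A_K^*:=A-BK^*$ (one has $\|A_K^*\|_*<1$). $Q_N\in\mathbb{R}^{n\times n}$ is a symmetric terminal cost matrix. Riccati difference equation: $P_N^*:=Q_N$ and, for $t=N-1,\dots,0$, $K_t^*:=(R+B^\top P_{t+1}^*B)^{-1}B^\top P_{t+1}^*A$, $P_t^*:=(A-BK_t^* )^\top P_{t+1}^*(A-BK_t^* )+(K_t^* )^\top RK_t^*+Q$. Backward recursion for the policies $\widetilde K_h$: $\widetilde P_N:=Q_N$ and, for $h=N-1,\dots,0$, $\widetilde P_h:=(A-B\widetilde K_h)^\top\widetilde P_{h+1}(A-B\widetilde K_h)+\widetilde K_h^\top R\widetilde K_h+Q$. The gain $\widetilde K_h^*$ is the minimizer of the surrogate finite-horizon cost at stage $h$, in which the downstream gains $\widetilde K_{h+1},\dots,\widetilde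 K_{N-1}$ are frozen. Constants: $P_{\max}:=\|P^*\|+\kappa_{P^*}\|Q_N-P^*\|_*$, $a:=\sigma_{\min}(Q)/2$, $\varphi:=\max_{t\in\{0,\dots,N-1\}}\|A-BK_t^*\|$, $C_1:=\varphi\|B\|/\lambda_{\min}(R)$, $C_3:=2(\|R\|+(P_{\max}+a)\|B\|^2)$, and $$\varsigma_{h,\epsilon}:=\min\left\{\sqrt{\tfrac{a}{C_3}\tfrac1N},\ \sqrt{\tfrac{a}{C_3}\tfrac{a}{2eNP_{\max}}},\ \sqrt{\tfrac{a}{C_3}\tfrac{\epsilon}{8eNC_1P_{\max}}},\ \sqrt{\tfrac{\epsilon}{4C_1C_3}}\right\}\ \text{for } h\ge1,\qquad \varsigma_{0,\epsilon}:=\frac{\epsilon}{4}.$$ *)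

(* Defs.v *)
From mathcomp Require Import all_boot all_order all_algebra.
From mathcomp Require Import all_classical all_reals all_analysis.
From mathcomp Require Import complex.

Set Implicit Arguments.
Unset Strict Implicit.
Unset Printing Implicit Defensive.

Import Order.TTheory GRing.Theory Num.Theory.

Local Open Scope classical_set_scope.
Local Open Scope ring_scope.

Section Matrices.
Variable F : realType.

Definition qform n (W : 'M[F]_n) (z : 'cV[F]_n) : F :=
  (z^T *m W *m z) ord0 ord0.

Definition posdef n (W : 'M[F]_n) : Prop :=
  W^T = W /\ forall z : 'cV[F]_n, z != 0 -> 0 < qform W z.

Definition possemidef n (W : 'M[F]_n) : Prop :=
  W^T = W /\ forall z : 'cV[F]_n, 0 <= qform W z.

(* The library's norm on matrices is the entrywise maximum, so the Euclidean
   norm is spelled out. *)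
Definition enorm n (z : 'cV[F]_n) : F := Num.sqrt (\sum_i z i ord0 ^+ 2).

Definition specnorm p q (X : 'M[F]_(p, q)) : F :=
  sup [set enorm (X *m z) / enorm z | z in [set z : 'cV[F]_q | z != 0]].

Definition wnorm n (W X : 'M[F]_n) : F :=
  Num.sqrt
    (sup [set qform W (X *m z) / qform W z | z in [set z : 'cV[F]_n | z != 0]]).

Definition cond_num n (X : 'M[F]_n) : F := specnorm X * specnorm (invmx X).

(* Only real eigenvalues are considered: meant for symmetric X. *)
Definition lambda_min n (X : 'M[F]_n) : F := inf [set a | eigenvalue X a].

Definition sigma_min n (X : 'M[F]_n) : F := Num.sqrt (lambda_min (X^T *m X)).

(* The eigenvalues range over the complex numbers F[i]; the norm of a complex
   number is itself an element of F[i], whence the outer Re. *)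
Definition spectral_radius n (X : 'M[F]_n) : F :=
  sup [set complex.Re `|l|
      | l in [set l : F[i] | eigenvalue (map_mx (real_complex F) X) l]].

End Matrices.

Section LQR.
Variables (F : realType) (n m : nat).
Variables (A : 'M[F]_n) (B : 'M[F]_(n, m)) (Q : 'M[F]_n) (R : 'M[F]_m).

Definition stabilizing (K : 'M[F]_(m, n)) : Prop :=
  spectral_radius (A - B *m K) < 1.

Definition stabilizable : Prop := exists K : 'M[F]_(m, n), stabilizing K.

Definition gain (P : 'M[F]_n) : 'M[F]_(m, n) :=
  invmx (R + B^T *m P *m B) *m B^T *m P *m A.

Definition dare_solution (P : 'M[F]_n) : Prop :=
  posdef P /\
  P = A^T *m P *m A
      - A^T *m P *m B *m invmx (R + B^T *m P *m B) *m B^T *m P *m A + Q.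

Definition cost_step (K : 'M[F]_(m, n)) (P : 'M[F]_n) : 'M[F]_n :=
  (A - B *m K)^T *m P *m (A - B *m K) + K^T *m R *m K + Q.

Variables (QN : 'M[F]_n) (N : nat).

(* The folds run over the stages t, ..., N-1 starting from the last one; for
   t = N the stage list is empty and the value is QN. *)
Definition riccati_cost (t : nat) : 'M[F]_n :=
  foldr (fun _ P => cost_step (gain P) P) QN (index_iota t N).

Definition riccati_gain (t : nat) : 'M[F]_(m, n) := gain (riccati_cost t.+1).

Definition policy_cost (Kt : nat -> 'M[F]_(m, n)) (h : nat) : 'M[F]_n :=
  foldr (fun t P => cost_step (Kt t) P) QN (index_iota h N).

Definition policy_opt_gain (Kt : nat -> 'M[F]_(m, n)) (h : nat) :
  'M[F]_(m, n) := gain (policy_cost Kt h.+1).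

(* P below stands for the solution of the algebraic Riccati equation. *)
Variables (P : 'M[F]_n) (eps : F).

Definition P_max : F := specnorm P + cond_num P * wnorm P (QN - P).

Definition a_const : F := sigma_min Q / 2.

Definition phi_max : F :=
  \big[Num.max/0]_(t < N) specnorm (A - B *m riccati_gain t).

Definition C1 : F := phi_max * specnorm B / lambda_min R.

Definition C3 : F :=
  2 * (specnorm R + (P_max + a_const) * specnorm B ^+ 2).

Definition varsigma (h : nat) : F :=
  let a := a_const in
  let e := expR 1 in
  if h is 0%N then eps / 4
  else Num.min (Num.sqrt (a / C3 * N%:R^-1))
      (Num.min (Num.sqrt (a / C3 * (a / (2 * e * N%:R * P_max))))
      (Num.min (Num.sqrt (a / C3 * (eps / (8 * e * N%:R * C1 * P_max))))
               (Num.sqrt (eps / (4 * C1 * C3))))).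

End LQR.

(* Main.v *)
Require Import Defs.
From mathcomp Require Import all_boot all_order all_algebra.
From mathcomp Require Import all_classical all_reals all_analysis.
From mathcomp Require Import complex.
From mathcomp Require Import ring lra.

(** The error of the first policy splits into three parts,
    $$ \widetilde K_0 - K^\star = (\widetilde K_0 - \widetilde K_0^\star)
       + (\widetilde K_0^\star - K_0^\star) + (K_0^\star - K^\star), $$
    the first of which is at most $\epsilon/4$ by assumption. The other two are
    differences of optimal gains for two terminal costs $P_1$, $P_2$. Since the
    optimal gain is the stationary point of the stage cost, such a difference
    is bounded by $\|A - B G_1\| \|B\| \lambda_{\min}(R)^{-1} \|P_2 - P_1\|$
    ([gain_lipschitz]), so it remains to compare cost matrices, which is done
    throughout through their quadratic forms.

    For the truncation part ([truncation_error]), the optimality of each gain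
    for its own stage gives
    $0 \preceq P_t^\star - P \preceq (A_K^\star)^T (P_{t+1}^\star - P) A_K^\star$.
    The closed loop contracts the norm of $P$, hence $P_t^\star - P$ decays
    geometrically ([riccati_cost_decay]); the horizon makes the result at most
    $\epsilon/2$.

    For the policy part ([tracking_error]), completing the square shows that a
    gain error $d$ costs only $O(d^2)$ ([cost_step_perturb]). The errors of the
    stages are accumulated as a multiplicative factor,
    $P_h^\star \preceq \widetilde P_h \preceq (1 + (N-h)\delta) P_h^\star$
    ([policy_cost_sandwich]). Optimal steps preserve such a factor, so that no
    bound on products of time-varying closed-loop matrices is required, and
    each stage increases it by $\delta$, a multiple of $d^2$. The tolerances
    make the accumulated difference at most $\epsilon/4$ after multiplication
    by $C_1$.

    Finally, a gain within $\epsilon$ of $K^\star$ still gives a contraction in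
    the norm of $P$ when $\epsilon$ is below the stated threshold, and a
    contraction in a weighted norm has spectral radius below $1$
    ([stabilizing_near], [spectral_radius_le]).

    The smallest eigenvalue is defined as an infimum over a possibly empty set;
    [lambda_min_eigenvalue] shows that it is attained and bounds the form from
    below, which is all the spectral theory used. *)

Set Implicit Arguments.
Unset Strict Implicit.
Unset Printing Implicit Defensive.

Import Order.TTheory GRing.Theory Num.Theory.

Local Open Scope ring_scope.

(** * Quadratic forms *)

Section QuadraticForms.
Variable F : realType.
Implicit Types n p q : nat.

Lemma le_of_eq (x y : F) : x = y -> x <= y.
Proof. by move=> ->. Qed.

Definition bform n (W : 'M[F]_n) (x y : 'cV[F]_n) : F :=
  (x^T *m W *m y) ord0 ord0.

Lemma bform_diag n (W : 'M[F]_n) z : bform W z z = qform W z.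
Proof. by []. Qed.

Lemma bformDl n (W : 'M[F]_n) x y z :
  bform W (x + y) z = bform W x z + bform W y z.
Proof. by rewrite /bform linearD /= !mulmxDl mxE. Qed.

Lemma bformDr n (W : 'M[F]_n) x y z :
  bform W z (x + y) = bform W z x + bform W z y.
Proof. by rewrite /bform mulmxDr mxE. Qed.

Lemma bformZl n (W : 'M[F]_n) a x y : bform W (a *: x) y = a * bform W x y.
Proof. by rewrite /bform linearZ /= -!scalemxAl mxE. Qed.

Lemma bformZr n (W : 'M[F]_n) a x y : bform W x (a *: y) = a * bform W x y.
Proof. by rewrite /bform -scalemxAr mxE. Qed.

Lemma bformC n (W : 'M[F]_n) x y : W^T = W -> bform W x y = bform W y x.
Proof.
move=> sW; rewrite /bform.
have -> : x^T *m W *m y = (y^T *m W *m x)^T.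
  by rewrite !trmx_mul trmxK sW mulmxA.
by rewrite mxE.
Qed.

Lemma bform_mxD n (W V : 'M[F]_n) x y :
  bform (W + V) x y = bform W x y + bform V x y.
Proof. by rewrite /bform mulmxDr mulmxDl mxE. Qed.

Lemma bform_mxN n (W : 'M[F]_n) x y : bform (- W) x y = - bform W x y.
Proof. by rewrite /bform mulmxN mulNmx mxE. Qed.

Lemma bform_congr n p (W : 'M[F]_n) (X : 'M[F]_(n, p)) x y :
  bform (X^T *m W *m X) x y = bform W (X *m x) (X *m y).
Proof. by rewrite /bform trmx_mul !mulmxA. Qed.

Lemma qformD n (W : 'M[F]_n) x y : W^T = W ->
  qform W (x + y) = qform W x + 2 * bform W x y + qform W y.
Proof.
move=> sW; rewrite -bform_diag bformDl !bformDr !bform_diag (bformC y x sW).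
ring.
Qed.

Lemma qformZ n (W : 'M[F]_n) a x : qform W (a *: x) = a ^+ 2 * qform W x.
Proof. by rewrite -bform_diag bformZl bformZr bform_diag; ring. Qed.

Lemma qformN n (W : 'M[F]_n) x : qform W (- x) = qform W x.
Proof. by rewrite -scaleN1r qformZ sqrrN expr1n mul1r. Qed.

Lemma qform0 n (W : 'M[F]_n) : qform W 0 = 0.
Proof. by rewrite -(scale0r 0) qformZ expr0n mul0r. Qed.

Lemma qform_mxD n (W V : 'M[F]_n) x : qform (W + V) x = qform W x + qform V x.
Proof. exact: bform_mxD. Qed.

Lemma qform_mxB n (W V : 'M[F]_n) x : qform (W - V) x = qform W x - qform V x.
Proof. by rewrite qform_mxD -[qform (- V) x]bform_diag bform_mxN. Qed.

Lemma qform_congr n p (W : 'M[F]_n) (X : 'M[F]_(n, p)) x :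
  qform (X^T *m W *m X) x = qform W (X *m x).
Proof. exact: bform_congr. Qed.

Lemma possemidef_congr n p (W : 'M[F]_n) (X : 'M[F]_(n, p)) :
  possemidef W -> possemidef (X^T *m W *m X).
Proof.
case=> sW W0; split; first by rewrite !trmx_mul trmxK sW mulmxA.
by move=> z; rewrite qform_congr.
Qed.

Lemma possemidefD n (W V : 'M[F]_n) :
  possemidef W -> possemidef V -> possemidef (W + V).
Proof.
move=> [sW W0] [sV V0]; split; first by rewrite linearD /= sW sV.
by move=> z; rewrite qform_mxD addr_ge0.
Qed.

Lemma posdef_semi n (W : 'M[F]_n) : posdef W -> possemidef W.
Proof.
case=> sW W0; split=> // z; have [->|/W0/ltW//] := eqVneq z 0.
by rewrite qform0.
Qed.

(** The polynomial $t \mapsto (x + ty)^T W (x + ty)$ is nonnegative, also when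
    $W$ has a kernel; its leading coefficient may then vanish, whence the three
    cases. *)
Lemma bform_CauchySchwarz n (W : 'M[F]_n) x y : possemidef W ->
  bform W x y ^+ 2 <= qform W x * qform W y.
Proof.
move=> [sW W0].
have key u v : 0 <= qform W v * (qform W u * qform W v - bform W u v ^+ 2).
  have := W0 (qform W v *: u + (- bform W u v) *: v).
  rewrite qformD // !qformZ bformZl bformZr; set b := bform W u v.
  by congr (_ <= _); ring.
have := W0 y; rewrite le_eqVlt => /predU1P[y0|y0]; last first.
  by have := key x y; rewrite pmulr_rge0 // subr_ge0.
have := W0 x; rewrite le_eqVlt => /predU1P[x0|x0]; last first.
  by have := key y x; rewrite pmulr_rge0 // subr_ge0 (bformC y x sW) mulrC.
have := W0 (x + (- bform W x y) *: y).
rewrite qformD // qformZ bformZr -x0 -y0 mulr0 addr0 add0r mul0r.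
lra.
Qed.

(** * Euclidean and spectral norms *)

Lemma enorm_ge0 n (z : 'cV[F]_n) : 0 <= enorm z.
Proof. exact: sqrtr_ge0. Qed.

Lemma qform1E n (z : 'cV[F]_n) : qform 1%:M z = \sum_i z i ord0 ^+ 2.
Proof.
rewrite /qform mulmx1 mxE; apply: eq_bigr => i _.
by rewrite mxE expr2.
Qed.

Lemma enorm_sqr n (z : 'cV[F]_n) : enorm z ^+ 2 = qform 1%:M z.
Proof. by rewrite qform1E sqr_sqrtr // sumr_ge0 // => i _; exact: sqr_ge0. Qed.

Lemma possemidef1 n : possemidef (1%:M : 'M[F]_n).
Proof. by split=> [|z]; rewrite ?trmx1 // -enorm_sqr sqr_ge0. Qed.

Lemma enorm0 n : enorm (0 : 'cV[F]_n) = 0.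
Proof. by apply/eqP; rewrite -sqrf_eq0 enorm_sqr qform0. Qed.

Lemma enorm_gt0 n (z : 'cV[F]_n) : z != 0 -> 0 < enorm z.
Proof.
move=> z0; rewrite lt_def enorm_ge0 andbT; apply: contraNneq z0 => ez.
have : \sum_i z i ord0 ^+ 2 = 0 by rewrite -qform1E -enorm_sqr ez expr0n.
move/psumr_eq0P => h; apply/eqP/matrixP => i j.
rewrite (ord1 j) [RHS]mxE; apply/eqP; rewrite -sqrf_eq0; apply/eqP.
by apply: h => // k _; exact: sqr_ge0.
Qed.

Lemma enorm_bform n (x y : 'cV[F]_n) : bform 1%:M x y <= enorm x * enorm y.
Proof.
have := bform_CauchySchwarz x y (possemidef1 n).
rewrite -!enorm_sqr -exprMn => h.
apply: le_trans (ler_norm _) _.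
rewrite -(ler_pXn2r (n := 2)) ?nnegrE ?mulr_ge0 ?enorm_ge0 //.
by rewrite real_normK ?num_real.
Qed.

Lemma enormD n (x y : 'cV[F]_n) : enorm (x + y) <= enorm x + enorm y.
Proof.
rewrite -(ler_pXn2r (n := 2)) ?nnegrE ?addr_ge0 ?enorm_ge0 //.
rewrite sqrrD !enorm_sqr qformD ?trmx1 // lerD2r lerD2l mulr2n.
by have := enorm_bform x y; lra.
Qed.

(** The Frobenius bound makes the supremum defining the spectral norm finite. *)
Lemma enorm_mulmx_bounded p q (X : 'M[F]_(p, q)) :
  exists C : F, forall z, enorm (X *m z) <= C * enorm z.
Proof.
pose S := \sum_i qform 1%:M (row i X)^T.
have S0 : 0 <= S by apply: sumr_ge0 => i _; case: (possemidef1 q) => _; apply.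
exists (Num.sqrt S) => z.
rewrite -(ler_pXn2r (n := 2)) ?nnegrE ?mulr_ge0 ?enorm_ge0 ?sqrtr_ge0 //.
rewrite exprMn (sqr_sqrtr S0) !enorm_sqr [leLHS]qform1E mulr_suml.
apply: ler_sum => i _.
have -> : (X *m z) i ord0 = bform 1%:M (row i X)^T z.
  by rewrite /bform trmxK mulmx1 -row_mul [RHS]mxE.
exact: (bform_CauchySchwarz _ _ (possemidef1 q)).
Qed.

Lemma enorm_mulmx_le p q (X : 'M[F]_(p, q)) z :
  enorm (X *m z) <= specnorm X * enorm z.
Proof.
have [->|z0] := eqVneq z 0; first by rewrite mulmx0 !enorm0 mulr0.
have [C hC] := enorm_mulmx_bounded X.
rewrite -ler_pdivrMr ?enorm_gt0 //; apply: sup_upper_bound; last by exists z.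
split; first by exists (enorm (X *m z) / enorm z), z.
by exists C => _ [y y0 <-]; rewrite ler_pdivrMr // enorm_gt0.
Qed.

Lemma specnorm_degenerate p q (X : 'M[F]_(p, q)) :
  ~ (exists z : 'cV[F]_q, z != 0) -> specnorm X = 0.
Proof.
move=> nz; rewrite /specnorm.
have -> : ([set z : 'cV[F]_q | z != 0] = set0)%classic.
  by apply/seteqP; split=> // z z0; apply: nz; exists z.
by rewrite image_set0 sup0.
Qed.

Lemma specnorm_le p q (X : 'M[F]_(p, q)) c : 0 <= c ->
  (forall z, enorm (X *m z) <= c * enorm z) -> specnorm X <= c.
Proof.
move=> c0 h; have [[z z0]|nz] := pselect (exists z : 'cV[F]_q, z != 0).
  apply: ge_sup; first by exists (enorm (X *m z) / enorm z), z.
  by move=> _ [y y0 <-]; rewrite ler_pdivrMr // enorm_gt0.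
by rewrite specnorm_degenerate.
Qed.

Lemma nonzero_cV n : (0 < n)%N -> exists z : 'cV[F]_n, z != 0.
Proof.
move=> n_gt0; exists (const_mx 1); apply/eqP => /matrixP.
by move=> /(_ (Ordinal n_gt0) ord0); rewrite !mxE => /eqP; rewrite oner_eq0.
Qed.

Lemma specnorm_ge0 p q (X : 'M[F]_(p, q)) : 0 <= specnorm X.
Proof.
have [[z z0]|nz] := pselect (exists z : 'cV[F]_q, z != 0).
  rewrite -(pmulr_lge0 _ (enorm_gt0 z0)).
  exact: le_trans (enorm_ge0 _) (enorm_mulmx_le _ _).
by rewrite specnorm_degenerate.
Qed.

Lemma specnormD p q (X Y : 'M[F]_(p, q)) :
  specnorm (X + Y) <= specnorm X + specnorm Y.
Proof.
apply: specnorm_le => [|z]; first by rewrite addr_ge0 ?specnorm_ge0.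
rewrite mulmxDl mulrDl; apply: le_trans (enormD _ _) _.
by rewrite lerD ?enorm_mulmx_le.
Qed.

Lemma bform_le n (W : 'M[F]_n) x y :
  bform W x y <= specnorm W * (enorm x * enorm y).
Proof.
have -> : bform W x y = bform 1%:M x (W *m y).
  by rewrite /bform mulmx1 mulmxA.
apply: le_trans (enorm_bform _ _) _.
by rewrite mulrCA ler_wpM2l ?enorm_ge0 ?enorm_mulmx_le.
Qed.

Lemma qform_le_specnorm n (W : 'M[F]_n) z :
  qform W z <= specnorm W * enorm z ^+ 2.
Proof. by rewrite expr2; exact: bform_le. Qed.

Lemma specnorm_posdef_gt0 n (W : 'M[F]_n) : (0 < n)%N -> posdef W ->
  0 < specnorm W.
Proof.
move=> n_gt0 W0; have [z z0] := nonzero_cV n_gt0.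
rewrite -(pmulr_lgt0 _ (exprn_gt0 2 (enorm_gt0 z0))).
exact: lt_le_trans (W0.2 _ z0) (qform_le_specnorm _ _).
Qed.

(** For a semidefinite form, $|Wz|^2$ is the value of the form at $(z, Wz)$,
    so that the Cauchy-Schwarz inequality of $W$ itself bounds it. *)
Lemma specnorm_possemidef_le n (W : 'M[F]_n) c : 0 <= c -> possemidef W ->
  (forall z, qform W z <= c * enorm z ^+ 2) -> specnorm W <= c.
Proof.
move=> c0 W0 h; apply: specnorm_le => // z.
have [->|e0] := eqVneq (enorm (W *m z)) 0.
  by rewrite mulr_ge0 ?enorm_ge0.
have e_gt0 : 0 < enorm (W *m z) by rewrite lt_def e0 enorm_ge0.
have := bform_CauchySchwarz (W *m z) z W0.
have -> : bform W (W *m z) z = enorm (W *m z) ^+ 2.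
  by rewrite enorm_sqr -bform_diag /bform mulmx1 mulmxA.
move=> /le_trans/(_ (ler_pM _ _ (h _) (h _))).
move=> /(_ (W0.2 _) (W0.2 _)) h2.
rewrite -(ler_pXn2r (n := 2)) ?nnegrE ?mulr_ge0 ?enorm_ge0 //.
rewrite -(ler_pM2r (exprn_gt0 2 e_gt0)) -expr2; apply: le_trans h2 _.
by apply: le_of_eq; ring.
Qed.

(** * Invertibility and smallest eigenvalues *)

Lemma posdef_unitmx n (W : 'M[F]_n) : posdef W -> W \in unitmx.
Proof.
move=> [sW W0]; rewrite -row_free_unit; apply: inj_row_free => v vW.
apply/eqP/negPn/negP => v0; have vT0 : v^T != 0 by rewrite trmx_eq0.
by have := W0 _ vT0; rewrite /qform trmxK vW mul0mx mxE ltxx.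
Qed.

(** Cauchy-Schwarz at $(z, W^{-1}z)$ gives
    $|z|^4 \le (z^T W z)(z^T W^{-1} z)$. *)
Lemma enorm_le_qform n (W : 'M[F]_n) z : possemidef W -> W \in unitmx ->
  enorm z ^+ 2 <= specnorm (invmx W) * qform W z.
Proof.
move=> W0 uW; have [->|z0] := eqVneq z 0.
  by rewrite enorm0 qform0 mulr0 expr0n.
have e_gt0 := exprn_gt0 2 (enorm_gt0 z0).
have := bform_CauchySchwarz z (invmx W *m z) W0.
have -> : bform W z (invmx W *m z) = enorm z ^+ 2.
  by rewrite /bform -mulmxA mulKVmx // enorm_sqr /qform mulmx1.
have -> : qform W (invmx W *m z) = qform (invmx W) z.
  rewrite -bform_diag /bform -mulmxA mulKVmx // trmx_mul trmx_inv W0.1.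
  by [].
move=> h; rewrite -(ler_pM2r e_gt0) -expr2; apply: le_trans h _.
by rewrite mulrC mulrAC ler_wpM2r ?W0.2 ?qform_le_specnorm.
Qed.

Lemma qform_scalar n (a : F) (z : 'cV[F]_n) :
  qform a%:M z = a * enorm z ^+ 2.
Proof.
by rewrite enorm_sqr /qform mul_mx_scalar mulmx1 -scalemxAl mxE.
Qed.

Lemma eigenvalue_qform n (W : 'M[F]_n) a : W^T = W -> eigenvalue W a ->
  exists2 z, z != 0 & W *m z = a *: z /\ qform W z = a * enorm z ^+ 2.
Proof.
move=> sW /eigenvalueP[v vW v0]; exists v^T; first by rewrite trmx_eq0.
split; first by rewrite -{1}sW -trmx_mul vW linearZ.
by rewrite enorm_sqr /qform trmxK vW mulmx1 -scalemxAl mxE.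
Qed.

(** The infimum $\mu$ of the Rayleigh quotient is an eigenvalue: were
    $W - \mu$ invertible, the bound $|z|^2 \le c\, z^T (W - \mu) z$ would
    push the infimum above $\mu$. *)
Lemma lambda_min_eigenvalue n (W : 'M[F]_n) : (0 < n)%N -> W^T = W ->
  eigenvalue W (lambda_min W) /\
  forall z, lambda_min W * enorm z ^+ 2 <= qform W z.
Proof.
move=> n_gt0 sW.
pose E := [set qform W z / enorm z ^+ 2
          | z in [set z : 'cV[F]_n | z != 0]]%classic.
have [z0 z0n0] := nonzero_cV n_gt0.
have E0 : (E !=set0)%classic by exists (qform W z0 / enorm z0 ^+ 2), z0.
have lE : has_lbound E.
  exists (- specnorm W) => _ [z zn0 <-].
  rewrite ler_pdivlMr ?exprn_gt0 ?enorm_gt0 // mulNr lerNl.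
  have -> : - qform W z = bform W (- z) z.
    by rewrite -bform_diag -[in RHS]scaleN1r bformZl mulN1r.
  apply: le_trans (bform_le _ _ _) _.
  have -> : enorm (- z) = enorm z; last by rewrite expr2.
  apply/eqP; rewrite -(eqrXn2 (n := 2)) ?enorm_ge0 // !enorm_sqr.
  by rewrite qformN.
pose mu := inf E.
have mu_le z : mu * enorm z ^+ 2 <= qform W z.
  have [->|zn0] := eqVneq z 0; first by rewrite enorm0 qform0 expr0n mulr0.
  rewrite -ler_pdivlMr ?exprn_gt0 ?enorm_gt0 //.
  by apply: ge_inf => //; exists z.
have psd : possemidef (W - mu%:M).
  split=> [|z]; first by rewrite linearB /= sW tr_scalar_mx.
  by rewrite qform_mxB qform_scalar subr_ge0.
have mu_eig : eigenvalue W mu.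
  rewrite /eigenvalue /eigenspace kermx_eq0 row_free_unit; apply/negP => uW.
  pose c := specnorm (invmx (W - mu%:M)) + 1.
  have c_gt0 : 0 < c by rewrite ltr_wpDl ?specnorm_ge0.
  suff : mu + c^-1 <= mu by rewrite gerDl leNgt invr_gt0 c_gt0.
  apply: lb_le_inf => // _ [z zn0 <-].
  rewrite ler_pdivlMr ?exprn_gt0 ?enorm_gt0 // mulrDl -lerBrDl.
  rewrite -(qform_scalar mu) -qform_mxB ler_pdivrMl //.
  apply: le_trans (enorm_le_qform z psd uW) _.
  by rewrite ler_wpM2r ?psd.2 // lerDl.
suff -> : lambda_min W = mu by [].
have mu_lb a : eigenvalue W a -> mu <= a.
  move=> /(eigenvalue_qform sW)[z zn0 [_ Wz]].
  by rewrite -(ler_pM2r (exprn_gt0 2 (enorm_gt0 zn0))) -Wz.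
apply/eqP; rewrite eq_le; apply/andP; split.
  by apply: ge_inf => //; exists mu => a; exact: mu_lb.
by apply: lb_le_inf; [exists mu | move=> a; exact: mu_lb].
Qed.

Lemma lambda_min_gt0 n (W : 'M[F]_n) : (0 < n)%N -> posdef W ->
  0 < lambda_min W.
Proof.
move=> n_gt0 [sW W0]; have [eW _] := lambda_min_eigenvalue n_gt0 sW.
have [z zn0 [_ Wz]] := eigenvalue_qform sW eW.
by have := W0 z zn0; rewrite Wz pmulr_lgt0 // exprn_gt0 ?enorm_gt0.
Qed.

Lemma sigma_min_gt0 n (W : 'M[F]_n) : (0 < n)%N -> posdef W ->
  0 < sigma_min W.
Proof.
move=> n_gt0 W0; rewrite sqrtr_gt0; apply: lambda_min_gt0 => //.
split=> [|z zn0]; first by rewrite trmx_mul trmxK.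
have -> : qform (W^T *m W) z = enorm (W *m z) ^+ 2.
  by rewrite enorm_sqr -qform_congr mulmx1.
apply/exprn_gt0/enorm_gt0; apply: contraNneq zn0 => Wz.
by rewrite -[z](mulKmx (posdef_unitmx W0)) Wz mulmx0.
Qed.

(** The square of the smallest eigenvalue of $W$ is an eigenvalue of
    $W^T W = W^2$, so that the smallest singular value cannot exceed the
    smallest eigenvalue. *)
Lemma sigma_min_le_qform n (W : 'M[F]_n) z : (0 < n)%N -> posdef W ->
  sigma_min W * enorm z ^+ 2 <= qform W z.
Proof.
move=> n_gt0 W0; have [sW _] := W0.
have [eW leW] := lambda_min_eigenvalue n_gt0 sW.
apply: le_trans (leW z); rewrite ler_wpM2r ?sqr_ge0 //.
have sWW : (W^T *m W)^T = W^T *m W by rewrite trmx_mul trmxK.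
have [_ leWW] := lambda_min_eigenvalue n_gt0 sWW.
have [y yn0 [Wy _]] := eigenvalue_qform sW eW.
have l_ge0 := ltW (lambda_min_gt0 n_gt0 W0).
rewrite -[leRHS]ger0_norm // -sqrtr_sqr.
rewrite ler_wsqrtr // -(ler_pM2r (exprn_gt0 2 (enorm_gt0 yn0))).
apply: le_trans (leWW y) _.
have -> : qform (W^T *m W) y = qform 1%:M (W *m y).
  by rewrite -qform_congr mulmx1.
by rewrite Wy qformZ enorm_sqr.
Qed.

End QuadraticForms.

(** * Weighted norms and the spectral radius *)

Section WeightedNorm.
Variable F : realType.

Lemma qform_mulmx_bounded n (W X : 'M[F]_n) : posdef W ->
  exists C, forall z, qform W (X *m z) <= C * qform W z.
Proof.
move=> W0; exists (specnorm W * specnorm X ^+ 2 * specnorm (invmx W)) => z.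
apply: le_trans (qform_le_specnorm _ _) _.
rewrite -[leRHS]mulrA -[leRHS]mulrA ler_wpM2l ?specnorm_ge0 //.
apply: (@le_trans _ _ (specnorm X ^+ 2 * enorm z ^+ 2)).
  by rewrite -exprMn lerXn2r ?nnegrE ?mulr_ge0 ?specnorm_ge0 ?enorm_ge0
    ?enorm_mulmx_le.
rewrite ler_wpM2l ?sqr_ge0 //.
exact: enorm_le_qform (posdef_semi W0) (posdef_unitmx W0).
Qed.

Lemma wnorm_ge0 n (W X : 'M[F]_n) : 0 <= wnorm W X.
Proof. exact: sqrtr_ge0. Qed.

Lemma qform_mulmx_wnorm n (W X : 'M[F]_n) z : posdef W ->
  qform W (X *m z) <= wnorm W X ^+ 2 * qform W z.
Proof.
move=> W0; have [C hC] := qform_mulmx_bounded X W0.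
have ratio_ge0 y : 0 <= qform W (X *m y) / qform W y.
  by rewrite divr_ge0 // (posdef_semi W0).2.
have [->|z0] := eqVneq z 0; first by rewrite mulmx0 !qform0 mulr0.
have qz_gt0 := W0.2 _ z0; rewrite -ler_pdivrMr //.
pose E := [set qform W (X *m y) / qform W y
          | y in [set y : 'cV[F]_n | y != 0]]%classic.
have le_sup : qform W (X *m z) / qform W z <= sup E.
  apply: sup_upper_bound; last by exists z.
  split; first by exists (qform W (X *m z) / qform W z), z.
  by exists C => _ [y y0 <-]; rewrite ler_pdivrMr ?W0.2.
by rewrite sqr_sqrtr // (le_trans _ le_sup).
Qed.

Lemma wnorm_le n (W X : 'M[F]_n) c : posdef W -> 0 <= c ->
  (forall z, qform W (X *m z) <= c ^+ 2 * qform W z) -> wnorm W X <= c.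
Proof.
move=> W0 c0 h; rewrite -[leRHS]ger0_norm // -sqrtr_sqr ler_wsqrtr //.
have [[z z0]|nz] := pselect (exists z : 'cV[F]_n, z != 0).
  apply: ge_sup; first by exists (qform W (X *m z) / qform W z), z.
  by move=> _ [y y0 <-]; rewrite ler_pdivrMr ?W0.2.
have -> : ([set z : 'cV[F]_n | z != 0] = set0)%classic.
  by apply/seteqP; split=> // z z0; apply: nz; exists z.
by rewrite image_set0 sup0 sqr_ge0.
Qed.

Lemma wnorm_eq0 n (W X : 'M[F]_n) : posdef W -> wnorm W X = 0 ->
  specnorm X = 0.
Proof.
move=> W0 w0; apply/eqP; rewrite eq_le specnorm_ge0 andbT.
apply: specnorm_le => // z; have [->|Xz] := eqVneq (X *m z) 0.
  by rewrite enorm0 mul0r.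
have := qform_mulmx_wnorm X z W0; rewrite w0 expr0n mul0r => /(lt_le_trans _).
by move=> /(_ _ (W0.2 _ Xz)); rewrite ltxx.
Qed.

Lemma qform_sqrtD n (W : 'M[F]_n) x y : possemidef W ->
  Num.sqrt (qform W (x + y)) <= Num.sqrt (qform W x) + Num.sqrt (qform W y).
Proof.
move=> [sW W0]; rewrite -(ler_pXn2r (n := 2)) ?nnegrE ?addr_ge0 ?sqrtr_ge0 //.
rewrite sqrrD !sqr_sqrtr // qformD // lerD2r lerD2l -sqrtrM // mulr2n.
suff : bform W x y <= Num.sqrt (qform W x * qform W y) by lra.
apply: le_trans (ler_norm _) _; rewrite -sqrtr_sqr ler_wsqrtr //.
exact: bform_CauchySchwarz.
Qed.

Lemma nonunit_kernel (K : fieldType) n (M : 'M[K]_n) : M \notin unitmx ->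
  exists2 z : 'cV[K]_n, z != 0 & M *m z = 0.
Proof.
rewrite -unitmx_tr -row_free_unit -kermx_eq0 => /rowV0Pn[v /sub_kermxP vM v0].
exists v^T; first by rewrite trmx_eq0.
by apply: trmx_inj; rewrite trmx_mul trmxK vM trmx0.
Qed.

(** The vectors are the real and imaginary parts of a right eigenvector, which
    exists because a singular matrix has a singular transpose. *)
Lemma complex_eigenvalue n (X : 'M[F]_n) (l : F[i]) :
  eigenvalue (map_mx (real_complex F) X) l ->
  exists x y : 'cV[F]_n, [/\ (x != 0) || (y != 0),
    X *m x = complex.Re l *: x - complex.Im l *: y &
    X *m y = complex.Im l *: x + complex.Re l *: y].
Proof.
rewrite /eigenvalue /eigenspace kermx_eq0 row_free_unit.
move=> /nonunit_kernel[z z0 /eqP]; rewrite mulmxBl subr_eq0 mul_scalar_mx.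
move=> /eqP Xz; pose x := map_mx (@complex.Re F) z.
pose y := map_mx (@complex.Im F) z; exists x, y.
have ReD : {morph @complex.Re F : u v / u + v} by case=> ? ? [].
have ImD : {morph @complex.Im F : u v / u + v} by case=> ? ? [].
split.
- apply: contraNT z0; rewrite negb_or !negbK => /andP[/eqP x0 /eqP y0].
  apply/eqP/matrixP => i j; move/matrixP/(_ i j): x0; move/matrixP/(_ i j): y0.
  by rewrite !mxE; case: (z i j) => a b /= -> ->.
- apply/matrixP => i j; move/matrixP/(_ i j)/(congr1 (@complex.Re F)): Xz.
  rewrite !mxE (big_morph _ ReD (erefl : complex.Re 0 = 0)) => Xz.
  transitivity (complex.Re (l * z i j)).
    rewrite -Xz; apply: eq_bigr => k _; rewrite !mxE.
    by case: (z k j) => a b /=; rewrite mul0r subr0.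
  by case: (z i j) l {Xz} => a b [c d].
- apply/matrixP => i j; move/matrixP/(_ i j)/(congr1 (@complex.Im F)): Xz.
  rewrite !mxE (big_morph _ ImD (erefl : complex.Im 0 = 0)) => Xz.
  transitivity (complex.Im (l * z i j)).
    rewrite -Xz; apply: eq_bigr => k _; rewrite !mxE.
    by case: (z k j) => a b /=; rewrite mul0r addr0.
  by case: (z i j) l {Xz} => a b [c d] /=; rewrite addrC.
Qed.

(** Summing the form over the real and imaginary parts of an eigenvector
    makes the cross terms cancel and leaves the factor $|\lambda|^2$. *)
Lemma spectral_radius_le n (W X : 'M[F]_n) c : posdef W -> 0 <= c ->
  (forall z, qform W (X *m z) <= c ^+ 2 * qform W z) ->
  spectral_radius X <= c.
Proof.
move=> W0 c0 h; have [[l0 l0e]|ne] :=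
    pselect (exists l, eigenvalue (map_mx (real_complex F) X) l); last first.
  rewrite /spectral_radius; have -> :
      ([set l | eigenvalue (map_mx (real_complex F) X) l] = set0)%classic.
    by apply/seteqP; split=> // l le; apply: ne; exists l.
  by rewrite image_set0 sup0.
apply: ge_sup; first by exists (complex.Re `|l0|), l0.
move=> _ [l /complex_eigenvalue[x [y [xy0 Xx Xy]]] <-].
rewrite normc_def /= -[leRHS]ger0_norm // -sqrtr_sqr ler_wsqrtr //.
have q_ge0 := (posdef_semi W0).2.
have q_gt0 : 0 < qform W x + qform W y.
  by case/orP: xy0 => /W0.2 ?; [apply: ltr_wpDr | apply: ltr_wpDl].
rewrite -(ler_pM2r q_gt0).
have := lerD (h x) (h y); rewrite Xx Xy -mulrDr; apply: le_trans.
rewrite -scaleNr !(qformD _ _ W0.1) !bformZl !bformZr !qformZ.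
by apply: le_of_eq; ring.
Qed.

End WeightedNorm.

(** * One step of the cost recursion *)

Section CostStep.
Variables (F : realType) (n m : nat).
Variables (A : 'M[F]_n) (B : 'M[F]_(n, m)) (Q : 'M[F]_n) (R : 'M[F]_m).
Hypotheses (posQ : posdef Q) (posR : posdef R).

Notation gain := (gain A B R).
Notation cost_step := (cost_step A B Q R).

Lemma qform_cost_step K P z :
  qform (cost_step K P) z =
    qform P ((A - B *m K) *m z) + qform R (K *m z) + qform Q z.
Proof. by rewrite !qform_mxD !qform_congr. Qed.

Lemma cost_step_possemidef K P : possemidef P -> possemidef (cost_step K P).
Proof.
move=> P0; apply: possemidefD; last exact: posdef_semi.
apply: possemidefD; apply: possemidef_congr => //; exact: posdef_semi.
Qed.

Lemma cost_step_mono K P1 P2 : (forall z, qform P1 z <= qform P2 z) ->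
  forall z, qform (cost_step K P1) z <= qform (cost_step K P2) z.
Proof. by move=> h z; rewrite !qform_cost_step !lerD2r. Qed.

(** The matrix $R + B^T P B$ is half the second derivative of the stage cost
    with respect to the input. *)
Lemma qform_Hessian P u :
  qform (R + B^T *m P *m B) u = qform R u + qform P (B *m u).
Proof. by rewrite qform_mxD qform_congr. Qed.

Lemma Hessian_unitmx P : possemidef P -> R + B^T *m P *m B \in unitmx.
Proof.
move=> P0; apply: posdef_unitmx; split.
  exact: (possemidefD (posdef_semi posR) (possemidef_congr B P0)).1.
by move=> z z0; rewrite qform_Hessian ltr_wpDr ?P0.2 ?posR.2.
Qed.

(** First-order optimality of the gain: the derivative of the stage cost
    in the direction $u$ of the input vanishes. *)
Lemma gain_stationary P u z : possemidef P ->
  bform R u (gain P *m z) = bform P (B *m u) ((A - B *m gain P) *m z).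
Proof.
move=> P0.
have h : bform (R + B^T *m P *m B) u (gain P *m z) = bform P (B *m u) (A *m z).
  rewrite /bform /Defs.gain; move: (Hessian_unitmx P0).
  by set S := R + _ => uS; rewrite trmx_mul -!mulmxA mulKVmx.
move: h; rewrite bform_mxD bform_congr mulmxBl -[B *m _ *m z]mulmxA bformDr.
rewrite -[- (B *m _)]scaleN1r bformZr mulN1r => <-.
by rewrite addrK.
Qed.

(** Stationarity of the gain makes the cross term vanish when the square is
    completed around it. *)
Lemma qform_cost_step_gain K P z : possemidef P ->
  qform (cost_step K P) z = qform (cost_step (gain P) P) z
    + qform (R + B^T *m P *m B) ((K - gain P) *m z).
Proof.
move=> P0; rewrite qform_Hessian !qform_cost_step.
set u := (K - gain P) *m z; set y := (A - B *m gain P) *m z.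
have -> : K *m z = u + gain P *m z by rewrite /u mulmxBl subrK.
have -> : (A - B *m K) *m z = y + - (B *m u).
  by rewrite /u /y !mulmxBl mulmxBr !mulmxA opprB addrA subrK.
rewrite (qformD u _ posR.1) (qformD y _ P0.1) qformN gain_stationary //.
rewrite -/y -[- (B *m u)]scaleN1r bformZr (bformC y _ P0.1).
ring.
Qed.

Lemma cost_step_gain_le K P z : possemidef P ->
  qform (cost_step (gain P) P) z <= qform (cost_step K P) z.
Proof.
move=> P0; rewrite (qform_cost_step_gain K) // lerDl qform_Hessian.
by rewrite addr_ge0 ?P0.2 // (posdef_semi posR).2.
Qed.

(** With $u = (G_2 - G_1)z$ and $S = R + B^T P_2 B$, stationarity of both
    gains gives $u^T S u = (Bu)^T (P_2 - P_1) (A - B G_1) z$. *)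
Lemma gain_lipschitz P1 P2 : (0 < m)%N -> possemidef P1 -> possemidef P2 ->
  specnorm (gain P2 - gain P1) <=
  specnorm (A - B *m gain P1) * specnorm B / lambda_min R * specnorm (P2 - P1).
Proof.
move=> m_gt0 P10 P20; have l_gt0 := lambda_min_gt0 m_gt0 posR.
apply: specnorm_le => [|z].
  by rewrite !mulr_ge0 ?specnorm_ge0 ?invr_ge0 // ltW.
set u := (gain P2 - gain P1) *m z; set y := (A - B *m gain P1) *m z.
have [->|u_neq0] := eqVneq (enorm u) 0.
  by rewrite !mulr_ge0 ?specnorm_ge0 ?enorm_ge0 ?invr_ge0 // ltW.
have u_gt0 : 0 < enorm u by rewrite lt_def u_neq0 enorm_ge0.
have quad : qform (R + B^T *m P2 *m B) u = bform (P2 - P1) (B *m u) y.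
  have s2 := gain_stationary u z P20; have s1 := gain_stationary u z P10.
  have g2 : gain P2 *m z = gain P1 *m z + u by rewrite /u mulmxBl addrC subrK.
  have y2 : (A - B *m gain P2) *m z = y + - (B *m u).
    by rewrite /u /y !mulmxBl mulmxBr !mulmxA opprB addrA subrK.
  move: s1 s2; rewrite g2 y2 -/y !bformDr -[- (B *m u)]scaleN1r bformZr.
  rewrite qform_Hessian bform_mxD bform_mxN !bform_diag.
  lra.
have low : lambda_min R * enorm u ^+ 2 <= qform (R + B^T *m P2 *m B) u.
  rewrite qform_Hessian -[leLHS]addr0 lerD ?P20.2 //.
  exact: (lambda_min_eigenvalue m_gt0 posR.1).2.
rewrite mulrAC -mulrA mulrAC ler_pdivlMr // -(ler_pM2r u_gt0).
rewrite [_ * lambda_min R]mulrC -mulrA -expr2; apply: le_trans low _.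
rewrite quad; apply: le_trans (bform_le _ _ _) _.
have hB := enorm_mulmx_le B u; have hy := enorm_mulmx_le (A - B *m gain P1) z.
have := ler_pM (enorm_ge0 _) (enorm_ge0 _) hB hy.
move=> /(ler_wpM2l (specnorm_ge0 (P2 - P1)))/le_trans; apply.
by apply: le_of_eq; ring.
Qed.

(** There is no first-order term because the optimal gain is stationary; this
    is why tolerances of the order of a square root suffice. *)
Lemma cost_step_perturb K P p d z : possemidef P -> 0 <= p ->
  (forall y, qform P y <= p * enorm y ^+ 2) -> specnorm (K - gain P) <= d ->
  qform (cost_step K P) z <= qform (cost_step (gain P) P) z
    + d ^+ 2 * (specnorm R + p * specnorm B ^+ 2) * enorm z ^+ 2.
Proof.
move=> P0 p0 Pp Kd; rewrite (qform_cost_step_gain K) // lerD2l qform_Hessian.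
set u := (K - gain P) *m z.
have d0 := le_trans (specnorm_ge0 _) Kd.
have hu : enorm u <= d * enorm z.
  apply: le_trans (enorm_mulmx_le _ _) _.
  by rewrite ler_wpM2r ?enorm_ge0.
have hu2 : enorm u ^+ 2 <= d ^+ 2 * enorm z ^+ 2.
  by rewrite -exprMn lerXn2r ?nnegrE ?mulr_ge0 ?enorm_ge0.
have hBu : enorm (B *m u) ^+ 2 <= specnorm B ^+ 2 * enorm u ^+ 2.
  by rewrite -exprMn lerXn2r ?nnegrE ?mulr_ge0 ?enorm_ge0 ?specnorm_ge0
    ?enorm_mulmx_le.
have hP := le_trans (Pp _) (ler_wpM2l p0 hBu).
apply: le_trans (lerD (qform_le_specnorm _ _) hP) _.
have c0 : 0 <= specnorm R + p * specnorm B ^+ 2.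
  by rewrite addr_ge0 ?mulr_ge0 ?specnorm_ge0 ?sqr_ge0.
by have := ler_wpM2l c0 hu2; lra.
Qed.

End CostStep.

(** * The Riccati difference equation *)

Section Recursions.
Variables (F : realType) (n m : nat).
Variables (A : 'M[F]_n) (B : 'M[F]_(n, m)) (Q : 'M[F]_n) (R : 'M[F]_m).
Variables (QN P : 'M[F]_n) (N : nat).
Hypothesis n_gt0 : (0 < n)%N.
Hypotheses (posQ : posdef Q) (posR : posdef R).
Hypotheses (dareP : dare_solution A B Q R P) (QN_ge_P : possemidef (QN - P)).

Notation gain := (gain A B R).
Notation cost_step := (cost_step A B Q R).
Notation ric := (riccati_cost A B Q R QN N).
Notation AK := (A - B *m gain P).
Notation rho := (wnorm P AK).
Notation a := (a_const Q).
Notation Pmax := (P_max QN P).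

Lemma foldr_index_iota (T : Type) (f : nat -> T -> T) x t : (t < N)%N ->
  foldr f x (index_iota t N) = f t (foldr f x (index_iota t.+1 N)).
Proof. by move=> tN; rewrite /index_iota -(subnSK tN). Qed.

Lemma foldr_index_iota_end (T : Type) (f : nat -> T -> T) x :
  foldr f x (index_iota N N) = x.
Proof. by rewrite /index_iota subnn. Qed.

Lemma downward_ind (S : nat -> Prop) : S N ->
  (forall t, (t < N)%N -> S t.+1 -> S t) -> forall t, (t <= N)%N -> S t.
Proof.
move=> SN step t /subKn <-; elim: (N - t)%N => [|k IH]; first by rewrite subn0.
have [kN|Nk] := ltnP k N; last first.
  by move: IH; rewrite subnS; have /eqP -> : (N - k == 0)%N by rewrite subn_eq0.
apply: step; first by rewrite subnS prednK ?subn_gt0 ?leq_subr.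
by rewrite subnSK.
Qed.

Lemma a_gt0 : 0 < a.
Proof. by rewrite divr_gt0 ?ltr0n ?sigma_min_gt0. Qed.

Lemma a_le_Q z : 2 * a * enorm z ^+ 2 <= qform Q z.
Proof.
have := sigma_min_le_qform z n_gt0 posQ; apply: le_trans.
by rewrite /a_const; lra.
Qed.

Let P_psd : possemidef P := posdef_semi dareP.1.

(** Stationarity turns the open-loop form of the Riccati equation into the
    closed-loop one, in which all three terms are nonnegative. *)
Lemma dare_fixpoint z : qform P z = qform (cost_step (gain P) P) z.
Proof.
rewrite {1}dareP.2 qform_mxD qform_mxB qform_congr qform_cost_step.
set G := gain P.
have -> : qform (A^T *m P *m B *m invmx (R + B^T *m P *m B) *m B^T *m P *m A) z
    = bform P (A *m z) (B *m (G *m z)).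
  by rewrite /qform /bform /G /Defs.gain trmx_mul !mulmxA.
have := gain_stationary A B posR (G *m z) z P_psd; rewrite -/G bform_diag => ->.
rewrite mulmxBl -[B *m G *m z]mulmxA -[- (B *m _)]scaleN1r.
rewrite qformD ?P_psd.1 // qformZ bformDr !bformZr bform_diag.
rewrite (bformC (A *m z) _ P_psd.1).
ring.
Qed.

Lemma P_ge_Q z : qform Q z <= qform P z.
Proof.
rewrite dare_fixpoint qform_cost_step lerDr addr_ge0 ?P_psd.2 //.
exact: (posdef_semi posR).2.
Qed.

(** Each closed-loop step decreases $z^T P z$ by at least
    $z^T Q z \ge 2a|z|^2 \ge (2a / \|P\|)\, z^T P z$. *)
Lemma closed_loop_contraction : rho < 1.
Proof.
have P0 := specnorm_posdef_gt0 n_gt0 dareP.1; have a0 := a_gt0.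
pose s := Num.max 0 (1 - 2 * a / specnorm P).
have s0 : 0 <= s by rewrite /s le_max lexx.
apply: (@le_lt_trans _ _ (Num.sqrt s)).
  apply: wnorm_le; [exact: dareP.1 | exact: sqrtr_ge0 | move=> z].
  rewrite (sqr_sqrtr s0).
  have q0 := P_psd.2 z.
  have step : qform P (AK *m z) <= (1 - 2 * a / specnorm P) * qform P z.
    have hR := (posdef_semi posR).2 (gain P *m z).
    have hP := dare_fixpoint z; rewrite qform_cost_step in hP.
    have hQ := a_le_Q z.
    have : 2 * a / specnorm P * qform P z <= 2 * a * enorm z ^+ 2.
      rewrite -[leLHS]mulrA ler_wpM2l //; first by rewrite mulr_ge0 // ltW.
      by rewrite ler_pdivrMl // qform_le_specnorm.
    by rewrite mulrBl mul1r; lra.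
  apply: le_trans step _; rewrite ler_wpM2r //.
  by rewrite /s le_max lexx orbT.
rewrite -sqrtr1 ltr_sqrt // /s gt_max ltr01 gtrDl oppr_lt0.
by rewrite /= divr_gt0 // mulr_gt0.
Qed.

(** In the inner product of $P$ one has
    $z^T (Q_N - P) z = \langle P^{-1}z, (Q_N - P)z\rangle_P$. *)
Lemma terminal_le z : qform (QN - P) z <=
  wnorm P (QN - P) * specnorm (invmx P) * qform P z.
Proof.
have uP := posdef_unitmx dareP.1; have q0 := P_psd.2 z.
set D := QN - P; set k := specnorm (invmx P); set w := wnorm P D.
have k0 : 0 <= k := specnorm_ge0 _; have w0 : 0 <= w := wnorm_ge0 _ _.
have -> : qform D z = bform P (invmx P *m z) (D *m z).
  rewrite /bform trmx_mul trmx_inv dareP.1.1 -[_ *m invmx P *m P]mulmxA.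
  by rewrite mulVmx // mulmx1 mulmxA.
have cs := bform_CauchySchwarz (invmx P *m z) (D *m z) P_psd.
have inv_le : qform P (invmx P *m z) <= k ^+ 2 * qform P z.
  have -> : qform P (invmx P *m z) = qform (invmx P) z.
    rewrite /qform trmx_mul trmx_inv dareP.1.1 -[_ *m invmx P *m P]mulmxA.
    by rewrite mulVmx // mulmx1 mulmxA.
  apply: le_trans (qform_le_specnorm _ _) _.
  by rewrite expr2 -[leRHS]mulrA ler_wpM2l // enorm_le_qform.
have sq := le_trans cs (ler_pM (P_psd.2 _) (P_psd.2 _) inv_le
  (qform_mulmx_wnorm D z dareP.1)).
apply: le_trans (ler_norm _) _.
rewrite -(ler_pXn2r (n := 2)) ?nnegrE ?mulr_ge0 // real_normK ?num_real //.
apply: le_trans sq _; rewrite -/w; apply: le_of_eq; ring.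
Qed.

Lemma riccati_cost_end : ric N = QN.
Proof. exact: foldr_index_iota_end. Qed.

Lemma riccati_cost_step t : (t < N)%N ->
  ric t = cost_step (gain (ric t.+1)) (ric t.+1).
Proof. exact: foldr_index_iota. Qed.

Lemma riccati_cost_possemidef t : (t <= N)%N -> possemidef (ric t).
Proof.
move: t; apply: downward_ind => [|t tN IH].
  by rewrite riccati_cost_end -(subrK P QN); exact: possemidefD.
by rewrite riccati_cost_step //; exact: cost_step_possemidef.
Qed.

(** Each gain of the difference equation is suboptimal for the terminal cost
    $P$, and the cost step is monotone in the terminal cost. *)
Lemma riccati_cost_ge t : (t <= N)%N -> forall z, qform P z <= qform (ric t) z.
Proof.
move: t; apply: downward_ind => [|t tN IH] z.
  by rewrite riccati_cost_end -subr_ge0 -qform_mxB QN_ge_P.2.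
rewrite riccati_cost_step // dare_fixpoint.
apply: le_trans (cost_step_gain_le A B Q posR (gain (ric t.+1)) z P_psd) _.
exact: cost_step_mono.
Qed.

(** Conversely the stationary gain is suboptimal for the difference equation,
    so that one backward step at most composes $P_{t+1}^\star - P$ with the
    stationary closed loop, a contraction in the norm of $P$. *)
Lemma riccati_cost_decay t : (t <= N)%N -> forall z, qform (ric t - P) z <=
  wnorm P (QN - P) * specnorm (invmx P) * rho ^+ (2 * (N - t)) * qform P z.
Proof.
set c := wnorm P (QN - P) * specnorm (invmx P).
have c0 : 0 <= c by rewrite mulr_ge0 ?wnorm_ge0 ?specnorm_ge0.
move: t; apply: downward_ind => [|t tN IH] z.
  by rewrite riccati_cost_end subnn muln0 expr0 mulr1 terminal_le.
have ric0 := riccati_cost_possemidef tN.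
apply: (@le_trans _ _ (qform (ric t.+1 - P) (AK *m z))).
  rewrite !qform_mxB (riccati_cost_step tN) [qform P z]dare_fixpoint.
  have := cost_step_gain_le A B Q posR (gain P) z ric0.
  by rewrite !qform_cost_step; lra.
apply: le_trans (IH _) _.
have -> : (2 * (N - t) = 2 * (N - t.+1) + 2)%N.
  by rewrite -(subnSK tN) mulnS addnC.
rewrite exprD [c * (_ * _)]mulrA -[leRHS]mulrA.
apply: ler_wpM2l; first by rewrite mulr_ge0 ?exprn_ge0 ?wnorm_ge0.
exact: qform_mulmx_wnorm dareP.1.
Qed.

Lemma riccati_cost_le_Pmax t z : (t <= N)%N ->
  qform (ric t) z <= Pmax * enorm z ^+ 2.
Proof.
move=> tN; have := riccati_cost_decay tN z; rewrite qform_mxB lerBlDr.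
move/le_trans; apply.
have rho1 : rho ^+ (2 * (N - t)) <= 1.
  by rewrite exprn_ile1 ?wnorm_ge0 // ltW // closed_loop_contraction.
set c := wnorm _ _ * specnorm _.
have c0 : 0 <= c by rewrite mulr_ge0 ?wnorm_ge0 ?specnorm_ge0.
have q0 := P_psd.2 z.
apply: (@le_trans _ _ ((c + 1) * qform P z)).
  by rewrite mulrDl mul1r lerD2r ler_wpM2r // ler_piMr.
have -> : Pmax = (c + 1) * specnorm P by rewrite /P_max /cond_num /c; ring.
by rewrite -mulrA ler_wpM2l ?addr_ge0 ?qform_le_specnorm.
Qed.

Lemma riccati_cost_dist t : (t <= N)%N -> specnorm (ric t - P) <=
  cond_num P * wnorm P (QN - P) * rho ^+ (2 * (N - t)).
Proof.
move=> tN; apply: specnorm_possemidef_le => [||z].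
- by rewrite !mulr_ge0 ?exprn_ge0 ?specnorm_ge0 ?wnorm_ge0.
- split=> [|z].
    by rewrite linearB /= dareP.1.1 (riccati_cost_possemidef tN).1.
  by rewrite qform_mxB subr_ge0 riccati_cost_ge.
apply: le_trans (riccati_cost_decay tN z) _; set r := rho ^+ _.
have r0 : 0 <= r by rewrite exprn_ge0 ?wnorm_ge0.
have c0 : 0 <= wnorm P (QN - P) * specnorm (invmx P) * r.
  by rewrite !mulr_ge0 ?wnorm_ge0 ?specnorm_ge0.
apply: le_trans (ler_wpM2l c0 (qform_le_specnorm _ _)) _.
by rewrite /cond_num; apply: le_of_eq; ring.
Qed.

Lemma a_le_riccati t z : (t <= N)%N -> 2 * a * enorm z ^+ 2 <= qform (ric t) z.
Proof.
move=> tN; apply: le_trans (a_le_Q z) _.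
exact: le_trans (P_ge_Q z) (riccati_cost_ge tN z).
Qed.

Lemma Pmax_gt0 : 0 < Pmax.
Proof.
apply: ltr_pwDl; first exact: specnorm_posdef_gt0 dareP.1.
by rewrite !mulr_ge0 ?specnorm_ge0 ?wnorm_ge0.
Qed.

(** * The recursion for approximately optimal policies *)

Section Policies.
Variables (Kt : nat -> 'M[F]_(m, n)) (d : F).

Notation pol := (policy_cost A B Q R QN N Kt).

Let delta := d ^+ 2 * C3 B Q R QN P / (4 * a).

Hypothesis Kt_close :
  forall h, (0 < h < N)%N -> specnorm (Kt h - gain (pol h.+1)) <= d.
Hypothesis delta_small : N%:R * delta * Pmax <= a.

Lemma policy_cost_end : pol N = QN.
Proof. exact: foldr_index_iota_end. Qed.

Lemma policy_cost_step t : (t < N)%N -> pol t = cost_step (Kt t) (pol t.+1).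
Proof. exact: foldr_index_iota. Qed.

Lemma delta_ge0 : 0 <= delta.
Proof.
have a0 := a_gt0; have Pm0 := Pmax_gt0.
have Pa0 : 0 <= Pmax + a by rewrite addr_ge0 // ltW.
rewrite /delta /C3 divr_ge0 //; last by rewrite mulr_ge0 // ltW.
apply: mulr_ge0; first exact: sqr_ge0.
by rewrite mulr_ge0 // addr_ge0 ?mulr_ge0 ?specnorm_ge0 ?sqr_ge0.
Qed.

(** The costs are compared multiplicatively: a stage in which the gain is
    off by $d$ adds at most $2a\delta|z|^2$ to the cost, which is at most
    $\delta$ times the optimal cost since the latter dominates $Q \succeq 2a$.
    The optimal step itself preserves a bound $\widetilde P \preceq c P$ with
    $c \ge 1$, so the factors $\delta$ simply add up, whatever the norms of the
    closed-loop matrices. *)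
Lemma policy_cost_sandwich h : (h <= N)%N -> (0 < h)%N ->
  possemidef (pol h) /\ forall z, qform (ric h) z <= qform (pol h) z
    <= (1 + (N - h)%:R * delta) * qform (ric h) z.
Proof.
have a0 := a_gt0; have d0 := delta_ge0; have Pm0 := Pmax_gt0.
move: h; apply: downward_ind => [_|h hN IH h_gt0].
  rewrite policy_cost_end riccati_cost_end subnn mul0r addr0.
  split=> [|z]; last by rewrite mul1r lexx.
  by rewrite -riccati_cost_end; exact: riccati_cost_possemidef.
have [pol0 sandwich] := IH isT; have ric0 := riccati_cost_possemidef hN.
rewrite policy_cost_step //; split; first exact: cost_step_possemidef.
move=> z; rewrite riccati_cost_step //; apply/andP; split.
  apply: (@le_trans _ _ (qform (cost_step (Kt h) (ric h.+1)) z)).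
    exact: cost_step_gain_le.
  by apply: cost_step_mono => y; case/andP: (sandwich y).
pose c := 1 + (N - h.+1)%:R * delta.
have c1 : 1 <= c by rewrite lerDl mulr_ge0.
have pol_le y : qform (pol h.+1) y <= (Pmax + a) * enorm y ^+ 2.
  have /andP[_] := sandwich y; move/le_trans; apply.
  apply: (@le_trans _ _ (c * (Pmax * enorm y ^+ 2))).
    by rewrite ler_wpM2l ?riccati_cost_le_Pmax // (le_trans ler01 c1).
  rewrite mulrA ler_wpM2r ?sqr_ge0 // /c mulrDl mul1r lerD2l.
  apply: le_trans delta_small; rewrite ler_wpM2r ?(ltW Pm0) // ler_wpM2r //.
  by rewrite ler_nat leq_subr.
have Pa0 : 0 <= Pmax + a by rewrite addr_ge0 // ltW.
have h0 : (0 < h < N)%N by rewrite h_gt0.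
apply: le_trans (cost_step_perturb Q posR z pol0 Pa0 pol_le (Kt_close h0)) _.
have -> : d ^+ 2 * (specnorm R + (Pmax + a) * specnorm B ^+ 2)
    = delta * (2 * a).
  have an0 : a != 0 by rewrite gt_eqF.
  by rewrite /delta /C3; field.
have opt : qform (cost_step (gain (pol h.+1)) (pol h.+1)) z
    <= c * qform (cost_step (gain (ric h.+1)) (ric h.+1)) z.
  apply: le_trans (cost_step_gain_le A B Q posR (gain (ric h.+1)) z pol0) _.
  rewrite !qform_cost_step; set y := (A - _) *m z.
  have := (andP (sandwich y)).2; rewrite -/c.
  have := ler_wpM2r ((posdef_semi posR).2 (gain (ric h.+1) *m z)) c1.
  have := ler_wpM2r ((posdef_semi posQ).2 z) c1.
  by rewrite !mul1r; lra.
apply: le_trans (lerD opt (lexx _)) _.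
rewrite -(riccati_cost_step hN) -(subnSK hN) -natr1.
have := ler_wpM2l d0 (a_le_riccati z (ltnW hN)); rewrite /c; lra.
Qed.

(** The total excess is at most $N \delta$ times the optimal cost, which is
    bounded by $P_{\max}$ at every stage. *)
Lemma policy_cost_dist h : (0 < h <= N)%N ->
  specnorm (pol h - ric h) <= N%:R * delta * Pmax.
Proof.
move=> /andP[h_gt0 hN]; have [pol0 sandwich] := policy_cost_sandwich hN h_gt0.
have ric0 := riccati_cost_possemidef hN.
have Nd0 : 0 <= N%:R * delta by rewrite mulr_ge0 ?delta_ge0.
apply: specnorm_possemidef_le => [||z].
- by rewrite mulr_ge0 // ltW // Pmax_gt0.
- split=> [|z]; first by rewrite linearB /= pol0.1 ric0.1.
  by rewrite qform_mxB subr_ge0; case/andP: (sandwich z).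
rewrite qform_mxB lerBlDr; have /andP[_] := sandwich z; move/le_trans; apply.
rewrite mulrDl mul1r addrC lerD2r -mulrA.
apply: (@le_trans _ _ (N%:R * delta * qform (ric h) z)).
  rewrite mulrA !ler_wpM2r ?ric0.2 ?delta_ge0 // ler_nat leq_subr //.
by rewrite -[leRHS]mulrA ler_wpM2l // riccati_cost_le_Pmax.
Qed.

End Policies.

End Recursions.

(** * The horizon and the final estimate *)

(** The horizon is chosen so that $2(N-1) \log(1/r) \ge \log Y$. A nonpositive
    $Y$, whose logarithm carries no information, satisfies the bound anyway. *)
Lemma horizon_decay (F : realType) (Y r : F) (N : nat) : 0 < r < 1 ->
  (0 < N)%N -> N%:Z = Num.ceil (1 / 2 * (ln Y / ln (1 / r)) + 1) ->
  Y * r ^+ (2 * (N - 1)) <= 1.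
Proof.
move=> /andP[r_gt0 r_lt1] N_gt0 N_def; have [Y_le0|Y_gt0] := leP Y 0.
  apply: (le_trans _ ler01); rewrite mulr_le0_ge0 // exprn_ge0 //.
  exact: ltW.
have ir_gt0 : 0 < 1 / r by rewrite divr_gt0.
have L_gt0 : 0 < ln (1 / r) by rewrite ln_gt0 // ltr_pdivlMr // mul1r.
have N_ge : 1 / 2 * (ln Y / ln (1 / r)) + 1 <= N%:R.
  by have := ceil_ge (1 / 2 * (ln Y / ln (1 / r)) + 1); rewrite -N_def.
have lnY : ln Y <= ln (1 / r) *+ (2 * (N - 1)).
  rewrite -mulr_natr mulrC -ler_pdivrMr // natrM natrB //.
  by move: N_ge; lra.
rewrite -lnXn // in lnY.
rewrite -ler_pdivlMr ?exprn_gt0 //; move: lnY.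
by rewrite ler_ln ?posrE ?exprn_gt0 // exprMn exprVn expr1n.
Qed.

Lemma sqr_le_of_le_sqrt (F : realType) (x y : F) : 0 <= x -> 0 <= y ->
  x <= Num.sqrt y -> x ^+ 2 <= y.
Proof.
move=> x0 y0; rewrite -{2}(sqr_sqrtr y0) => h.
by rewrite lerXn2r ?nnegrE ?sqrtr_ge0.
Qed.

Section Estimates.
Variables (F : realType) (n m : nat).
Variables (A : 'M[F]_n) (B : 'M[F]_(n, m)) (Q : 'M[F]_n) (R : 'M[F]_m).
Variables (QN P : 'M[F]_n) (eps : F) (N : nat).
Hypotheses (n_gt0 : (0 < n)%N) (m_gt0 : (0 < m)%N).
Hypotheses (posQ : posdef Q) (posR : posdef R).
Hypotheses (dareP : dare_solution A B Q R P) (QN_ge_P : possemidef (QN - P)).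
Hypotheses (eps_gt0 : 0 < eps) (N_gt0 : (0 < N)%N).

Notation gain := (gain A B R).
Notation AK := (A - B *m gain P).
Notation ric := (riccati_cost A B Q R QN N).
Notation a := (a_const Q).
Notation Pmax := (P_max QN P).
Notation C1 := (C1 A B Q R QN N).
Notation C3 := (C3 B Q R QN P).

(** The second and third terms of the minimum defining the tolerance of the
    stages $h \ge 1$: the second keeps the excess cost below $a$, the third
    keeps its effect on the first gain below $\epsilon/4$. *)
Definition policy_tolerance : F :=
  Num.min (Num.sqrt (a / C3 * (a / (2 * expR 1 * N%:R * Pmax))))
          (Num.sqrt (a / C3 * (eps / (8 * expR 1 * N%:R * C1 * Pmax)))).

Lemma varsigma_le h : (0 < h)%N ->
  varsigma A B Q R QN N P eps h <= policy_tolerance.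
Proof.
by case: h => // h _; rewrite /varsigma /policy_tolerance le_min !ge_min !lexx
  !orbT.
Qed.

Lemma policy_tolerance_ge0 : 0 <= policy_tolerance.
Proof. by rewrite le_min !sqrtr_ge0. Qed.

Lemma C1_ge0 : 0 <= C1.
Proof.
rewrite /Defs.C1 divr_ge0 ?(ltW (lambda_min_gt0 m_gt0 posR)) //.
rewrite mulr_ge0 ?specnorm_ge0 // /phi_max.
by elim/big_rec: _ => // i x _ x0; rewrite le_max x0 orbT.
Qed.

Lemma C3_gt0 : 0 < C3.
Proof.
have a0 := a_gt0 n_gt0 posQ.
have Pm0 : 0 < Pmax := Pmax_gt0 QN n_gt0 dareP.
rewrite mulr_gt0 //; apply: ltr_pwDl; first exact: specnorm_posdef_gt0.
by rewrite mulr_ge0 ?sqr_ge0 // addr_ge0 // ltW.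
Qed.

Let excess := N%:R * (policy_tolerance ^+ 2 * C3 / (4 * a)) * Pmax.

(** The tolerance enters the excess squared, and $y = a$ or
    $y = \epsilon/(4 C_1)$ recovers one of its two terms. *)
Lemma excess_le y : 0 <= y ->
  policy_tolerance <= Num.sqrt (a / C3 * (y / (2 * expR 1 * N%:R * Pmax))) ->
  excess <= y / (8 * expR 1).
Proof.
have a0 := a_gt0 n_gt0 posQ.
have Pm0 : 0 < Pmax := Pmax_gt0 QN n_gt0 dareP.
have C0 := C3_gt0; have e0 := expR_gt0 (1 : F); move=> y0.
have N0 : 0 < N%:R :> F by rewrite ltr0n.
set w := a / C3 * _ => tol.
have den0 : 0 < 2 * expR 1 * N%:R * Pmax by rewrite !mulr_gt0.
have w0 : 0 <= w by apply: mulr_ge0; apply: divr_ge0 => //; exact: ltW.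
have tol2 := sqr_le_of_le_sqrt policy_tolerance_ge0 w0 tol.
have -> : y / (8 * expR 1) = N%:R * (w * C3 / (4 * a)) * Pmax.
  by rewrite /w; field; rewrite !gt_eqF.
apply: ler_wpM2r; first exact: ltW.
apply: ler_wpM2l; first exact: ltW.
apply: ler_wpM2r; first by rewrite invr_ge0 mulr_ge0 // ltW.
by apply: ler_wpM2r; first exact: ltW.
Qed.

Lemma excess_le_a : excess <= a.
Proof.
have a0 := a_gt0 n_gt0 posQ.
apply: le_trans (excess_le (ltW a0) _) _; first by rewrite ge_min lexx.
have e1 : 1 <= expR (1 : F) by have := expR_ge1Dx (1 : F); lra.
by rewrite ler_pdivrMr; nra.
Qed.

(** When $C_1 = 0$ the tolerance involving $C_1$ degenerates, but there is then
    nothing to bound. *)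
Lemma C1_excess_le : C1 * excess <= eps / 4.
Proof.
have a0 := a_gt0 n_gt0 posQ.
have Pm0 : 0 < Pmax := Pmax_gt0 QN n_gt0 dareP.
have := C1_ge0; rewrite le_eqVlt => /predU1P[<-|C10].
  by rewrite mul0r divr_ge0 // ltW.
have e1 : 1 <= expR (1 : F) by have := expR_ge1Dx (1 : F); lra.
have e0 := expR_gt0 (1 : F); have N0 : 0 < N%:R :> F by rewrite ltr0n.
rewrite -ler_pdivlMl //.
apply: (le_trans (excess_le (y := eps / (4 * C1)) _ _)).
- by apply: divr_ge0; [exact: ltW | apply: mulr_ge0 => //; exact: ltW].
- rewrite ge_min; apply/orP; right; apply: le_of_eq.
  by congr (Num.sqrt (_ * _)); field; rewrite !gt_eqF.
have -> : eps / (4 * C1) / (8 * expR 1) = (C1^-1 * (eps / 4)) / (8 * expR 1).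
  by field; rewrite !gt_eqF.
have x0 : 0 <= C1^-1 * (eps / 4).
  by apply: mulr_ge0; [rewrite invr_ge0 | apply: divr_ge0 => //]; exact: ltW.
by rewrite ler_pdivrMr; nra.
Qed.

(** Even for exactly optimal policies, the finite horizon leaves an error in
    the first gain: by the Lipschitz bound on gains it is at most
    $\|A_K^\star\|\|B\|\lambda_{\min}(R)^{-1} \|P_1^\star - P\|$, and
    $\|P_1^\star - P\|$ has decayed by the factor $\|A_K^\star\|_*^{2(N-1)}$. *)
Lemma truncation_error :
  N%:Z = Num.ceil (1 / 2 *
     (ln (2 * wnorm P (QN - P) * cond_num P * specnorm AK * specnorm B /
          (eps * lambda_min R)) / ln (1 / wnorm P AK)) + 1) ->
  specnorm (gain (ric 1) - gain P) <= eps / 2.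
Proof.
set w := wnorm P (QN - P); set k := cond_num P; set b := specnorm B.
set g := specnorm AK; set l := lambda_min R; set r := wnorm P AK => N_def.
have l0 : 0 < l := lambda_min_gt0 m_gt0 posR.
have P0 := posdef_semi dareP.1.
have ric0 := riccati_cost_possemidef posQ posR dareP QN_ge_P N_gt0.
apply: le_trans (gain_lipschitz A B posR m_gt0 P0 ric0) _; rewrite -/g -/b -/l.
have gbl0 : 0 <= g * b / l by rewrite divr_ge0 ?mulr_ge0 ?specnorm_ge0 // ltW.
have dist := riccati_cost_dist posQ posR dareP QN_ge_P N_gt0.
apply: le_trans (ler_wpM2l gbl0 dist) _; rewrite -/w -/k -/r.
have -> : g * b / l * (k * w * r ^+ (2 * (N - 1))) =
    eps / 2 * (2 * w * k * g * b / (eps * l) * r ^+ (2 * (N - 1))).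
  by field; rewrite !gt_eqF.
rewrite ger_pMr; last by rewrite divr_gt0.
(* A zero closed loop makes the logarithm meaningless, but
   then the factor $\|A_K^\star\|$ of the bound is zero as well. *)
have := wnorm_ge0 P AK; rewrite le_eqVlt => /predU1P[r0|r0].
  rewrite (_ : g = 0) ?mulr0 ?mul0r //.
  exact: wnorm_eq0 dareP.1 (esym r0).
apply: horizon_decay => //.
by rewrite /r r0 (closed_loop_contraction n_gt0 posQ posR dareP).
Qed.

(** In the norm of $P$, perturbing the gain by at most $\epsilon$ perturbs the
    closed loop by at most $\kappa_P^{1/2} \|B\| \epsilon$, which the bound on
    $\epsilon$ makes smaller than the contraction margin. *)
Lemma stabilizing_near K : specnorm (K - gain P) <= eps ->
  eps < (1 - wnorm P AK) / (Num.sqrt (cond_num P) * specnorm B) ->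
  stabilizing A B K.
Proof.
set r := wnorm P AK; set k := cond_num P; set b := specnorm B => Keps eps_lt.
have r0 : 0 <= r := wnorm_ge0 _ _.
have b0 : 0 <= b := specnorm_ge0 _.
(* Otherwise the quotient bounding $\epsilon$ is zero. *)
have kb0 : 0 < Num.sqrt k * b.
  rewrite lt_def mulr_ge0 ?sqrtr_ge0 // andbT; apply: contraTneq eps_lt => ->.
  by rewrite invr0 mulr0 -leNgt ltW.
pose c := r + Num.sqrt k * b * eps.
have c1 : c < 1 by move: eps_lt; rewrite ltr_pdivlMr // /c; lra.
have c0 : 0 <= c by rewrite addr_ge0 // mulr_ge0 // ltW.
apply: le_lt_trans c1; apply: (spectral_radius_le dareP.1 c0) => z.
have P0 := posdef_semi dareP.1.
rewrite -[leRHS]sqr_sqrtr; last by rewrite mulr_ge0 ?sqr_ge0 ?P0.2.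
rewrite -[leLHS]sqr_sqrtr ?P0.2 //.
rewrite lerXn2r ?nnegrE ?sqrtr_ge0 // sqrtrM ?sqr_ge0 // sqrtr_sqr ger0_norm //.
have -> : (A - B *m K) *m z = AK *m z + - (B *m ((K - gain P) *m z)).
  by rewrite !mulmxBl mulmxBr !mulmxA opprB addrA subrK.
apply: le_trans (qform_sqrtD _ _ P0) _; rewrite qformN /c mulrDl.
apply: lerD.
  rewrite -[r]ger0_norm // -sqrtr_sqr -sqrtrM ?sqr_ge0 // ler_wsqrtr //.
  exact: qform_mulmx_wnorm dareP.1.
have be0 : 0 <= b * eps by rewrite mulr_ge0 // ltW.
have k0 : 0 <= k by rewrite mulr_ge0 ?specnorm_ge0.
have -> : Num.sqrt k * b * eps = Num.sqrt (k * (b * eps) ^+ 2).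
  by rewrite [RHS]sqrtrM // sqrtr_sqr ger0_norm // mulrA.
rewrite -sqrtrM; last by rewrite mulr_ge0 ?sqr_ge0.
rewrite ler_wsqrtr //; set u := (K - gain P) *m z.
have hu : enorm u <= eps * enorm z.
  apply: le_trans (enorm_mulmx_le _ _) _.
  by rewrite ler_wpM2r ?enorm_ge0.
have hBu : enorm (B *m u) <= b * eps * enorm z.
  apply: le_trans (enorm_mulmx_le _ _) _.
  by rewrite -mulrA ler_wpM2l.
apply: le_trans (qform_le_specnorm _ _) _.
have hBu2 : enorm (B *m u) ^+ 2 <= (b * eps) ^+ 2 * enorm z ^+ 2.
  by rewrite -exprMn lerXn2r ?nnegrE ?mulr_ge0 ?enorm_ge0 // ltW.
have hz := enorm_le_qform z P0 (posdef_unitmx dareP.1).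
apply: le_trans (ler_wpM2l (specnorm_ge0 P) hBu2) _.
apply: le_trans (ler_wpM2l (specnorm_ge0 P) (ler_wpM2l (sqr_ge0 _) hz)) _.
by rewrite /k /cond_num; apply: le_of_eq; ring.
Qed.

(** The gains $\widetilde K_1, \widetilde K_2, \dots$ influence the optimal
    first gain only through $\widetilde P_1$, which is compared with
    $P_1^\star$. *)
Lemma tracking_error (Kt : nat -> 'M[F]_(m, n)) :
  (forall h, (h < N)%N ->
     specnorm (Kt h - policy_opt_gain A B Q R QN N Kt h)
       <= varsigma A B Q R QN N P eps h) ->
  specnorm (gain (policy_cost A B Q R QN N Kt 1) - gain (ric 1)) <= eps / 4.
Proof.
move=> Kt_close.
have Kt_tol h : (0 < h < N)%N ->
    specnorm (Kt h - gain (policy_cost A B Q R QN N Kt h.+1))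
      <= policy_tolerance.
  by case/andP=> h0 /Kt_close/le_trans; apply; exact: varsigma_le.
have ric0 := riccati_cost_possemidef posQ posR dareP QN_ge_P N_gt0.
have [pol0 _] := policy_cost_sandwich n_gt0 posQ posR dareP QN_ge_P Kt_tol
  excess_le_a N_gt0 isT.
have h1 : (0 < 1 <= N)%N by [].
have dist := policy_cost_dist n_gt0 posQ posR dareP QN_ge_P Kt_tol
  excess_le_a h1.
apply: le_trans (gain_lipschitz A B posR m_gt0 ric0 pol0) _.
apply: le_trans C1_excess_le.
apply: ler_pM; rewrite ?specnorm_ge0 //.
  rewrite divr_ge0 ?mulr_ge0 ?specnorm_ge0 //.
  exact: ltW (lambda_min_gt0 m_gt0 posR).
rewrite /Defs.C1 ler_wpM2r ?invr_ge0 ?(ltW (lambda_min_gt0 m_gt0 posR)) //.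
rewrite ler_wpM2r ?specnorm_ge0 //.
exact: (le_bigmax _ (fun t : 'I_N =>
  specnorm (A - B *m riccati_gain A B Q R QN N t)) (Ordinal N_gt0)).
Qed.

End Estimates.

Theorem theorem3p2 (F : realType) (n m : nat)
    (A : 'M[F]_n) (B : 'M[F]_(n, m)) (Q : 'M[F]_n) (R : 'M[F]_m)
    (QN P : 'M[F]_n) (eps : F) (N : nat) (Kt : nat -> 'M[F]_(m, n))
    (stabAB : stabilizable A B)
    (posQ : posdef Q) (posR : posdef R)
    (dareP : dare_solution A B Q R P)
    (symQN : QN^T = QN) (QN_ge_P : possemidef (QN - P))
    (eps_gt0 : 0 < eps)
    (A_neq0 : A != 0) (B_neq0 : B != 0) (QN_neqP : QN != P)
    (N_gt0 : (0 < N)%N)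
    (N_def : N%:Z =
       Num.ceil (1 / 2 *
         (ln (2 * wnorm P (QN - P) * cond_num P *
              specnorm (A - B *m gain A B R P) * specnorm B /
              (eps * lambda_min R)) /
          ln (1 / wnorm P (A - B *m gain A B R P))) + 1))
    (Kt_close : forall h : nat, (h < N)%N ->
       specnorm (Kt h - policy_opt_gain A B Q R QN N Kt h)
         <= varsigma A B Q R QN N P eps h) :
  specnorm (Kt 0%N - gain A B R P) <= eps /\
  (eps < (1 - wnorm P (A - B *m gain A B R P)) /
         (Num.sqrt (cond_num P) * specnorm B) ->
   stabilizing A B (Kt 0%N)).
Proof.
have [n_gt0 m_gt0] : (0 < n)%N /\ (0 < m)%N.
  move: B_neq0; case: (n) (B) => [|n'] B'; first by rewrite flatmx0 eqxx.
  by case: (m) B' => [|m'] B'; first by rewrite thinmx0 eqxx.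
suff Kt_eps : specnorm (Kt 0%N - gain A B R P) <= eps.
  by split=> // small; exact: (stabilizing_near dareP eps_gt0 Kt_eps small).
have stage0 := Kt_close _ N_gt0.
have track := tracking_error n_gt0 m_gt0 posQ posR dareP QN_ge_P eps_gt0 N_gt0
  Kt_close.
have trunc := truncation_error n_gt0 m_gt0 posQ posR dareP QN_ge_P eps_gt0
  N_gt0 N_def.
set g1 := gain A B R (policy_cost A B Q R QN N Kt 1) in track.
set g2 := gain A B R (riccati_cost A B Q R QN N 1) in track trunc.
have -> : Kt 0%N - gain A B R P =
    (Kt 0%N - g1) + ((g1 - g2) + (g2 - gain A B R P)).
  by rewrite !addrA !subrK.
apply: le_trans (specnormD _ _) _.
apply: le_trans (lerD stage0 (le_trans (specnormD _ _) (lerD track trunc))) _.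
by rewrite /varsigma; apply: le_of_eq; field.
Qed.
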